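(* Let $(M,\Sigma_M,\mu,T)$ be a Bernoulli system, where $(M,d_M)$ is a separable metric space and $\Sigma_M$ contains all open balls of $(M,d_M)$. Then for every $\varepsilon>0$ there is an irreducible and aperiodic Markov process, with outcome space a finite subset of $M$, such that $(M,\Sigma_M,\mu,T)$ is $\varepsilon$-congruent to (the deterministic representation of) this Markov process.
   Context: A deterministic system is a quadruple $(M,\Sigma_M,\mu,T)$ where $(M,\Sigma_M,\mu)$ is a probability space and $T:M\to M$ is a bijection with $T,T^{-1}$ measurable; measure-preserving means $\mu(T(A))=\mu(A)$ for all $A\in\Sigma_M$. A Bernoulli process is a stochastic process $\{Z_t;t\in\mathbb{Z}\}$ with finite outcome space $\{s_1,\dots,s_N\}$ (power-set $\sigma$-algebra), $P\{Z_t=s_k\}=p_k$ for all $t,k$, and the $Z_t$ independent. The deterministic representation of a process $\{Z_t\}$ with values in $(\bar M,\Sigma_{\bar M})$ is $(M_2,\Sigma_{M_2},\mu_2,T_2,\Phi_0)$: $M_2$ is the set of bi-infinite sequences over $\bar M$, $\Sigma_{M_2}$ is generated by cylinder sets $\{m:m_{i_1}\in A_1,\dots,m_{i_n}\in A_n\}$, $\mu_2$ is the unique measure giving each cylinder probability $P\{Z_{i_1}\in A_1,\dots,Z_{i_n}\in A_n\}$, $T_2$ is the left shift, $\Phi_0(m)=m_0$. The deterministic representation of a Bernoulli process is a Bernoulli shift. Two measure-preserving systems are isomorphic if there are full-measure measurable subsets $\hat M_1,\hat M_2$ with $T_i\hat M_i\subseteq\hat M_i$ and a bijection $\phi:\hat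 M_1\to\hat M_2$ such that $\phi,\phi^{-1}$ preserve measurability, $\phi$ preserves measure, and $\phi\circ T_1=T_2\circ\phi$ on $\hat M_1$. A Bernoulli system is a measure-preserving system isomorphic to a Bernoulli shift. A Markov process is a stationary process with finite outcome space $\{s_1,\dots,s_N\}$ such that $P\{Z_{t+1}=s_j\mid Z_t,Z_{t-1},\dots,Z_k\}=P\{Z_{t+1}=s_j\mid Z_t\}$ for all $t$, $k\le t$, $j$. With $P^k(s_i,s_j):=P\{Z_{n+k}=s_i\mid Z_n=s_j\}$, it is irreducible if for all $i,j$ there is $k\in\mathbb{N}$ with $P^k(s_i,s_j)>0$, and aperiodic if for each $i$, $\gcd\{n\ge1: P^n(s_i,s_i)>0\}=1$. $(M,\Sigma_M,\mu,T)$ is $\varepsilon$-congruent to the deterministic representation $(M_2,\Sigma_{M_2},\mu_2,T_2,\Phi_0)$ of a stationary process with values in $M$ if it is isomorphic to $(M_2,\Sigma_{M_2},\mu_2,T_2)$ via some $\phi$ and $d_M(m,\Phi_0(\phi(m)))<\varepsilon$ for all $m$ outside a set of $\mu$-measure $<\varepsilon$. *)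

(* Defs.v *)
From HB Require Import structures.
From mathcomp Require Import all_boot all_order all_algebra.
From mathcomp Require Import all_classical all_reals all_analysis.

Set Implicit Arguments.
Unset Strict Implicit.
Unset Printing Implicit Defensive.
Import Order.TTheory GRing.Theory Num.Theory.
Local Open Scope classical_set_scope.
Local Open Scope ring_scope.

(* A finite outcome space with N.+1 elements is modelled by the ordinal type
   'I_N.+1 (an outcome space of a probability process is nonempty). *)
HB.instance Definition _ (N : nat) := isPointed.Build 'I_N.+1 ord0.

Section Defs.
Variable R : realType.

Definition is_metric (M : Type) (dist : M -> M -> R) : Prop :=
  (forall x y, 0 <= dist x y) /\
  (forall x y, dist x y = 0 <-> x = y) /\
  (forall x y, dist x y = dist y x) /\
  (forall x y z, dist x z <= dist x y + dist y z).

Definition open_ball (M : Type) (dist : M -> M -> R) (x : M) (r : R) : set M :=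
  [set y | dist x y < r].

Definition separable_metric (M : Type) (dist : M -> M -> R) : Prop :=
  exists D : set M, countable D /\
    forall x (e : R), 0 < e -> exists2 y, D y & dist x y < e.

Definition measure_preserving_system (d : measure_display) (M : measurableType d)
  (mu : probability M R) (T : M -> M) : Prop :=
  exists Tinv : M -> M,
    cancel T Tinv /\ cancel Tinv T /\
    measurable_fun setT T /\ measurable_fun setT Tinv /\
    (forall A, measurable A -> mu (T @` A) = mu A).

Definition isomorphic_via (d1 d2 : measure_display)
  (M1 : measurableType d1) (M2 : measurableType d2)
  (mu1 : probability M1 R) (T1 : M1 -> M1)
  (mu2 : probability M2 R) (T2 : M2 -> M2) (phi : M1 -> M2) : Prop :=
  exists (H1 : set M1) (H2 : set M2),
    [/\ measurable H1, measurable H2, mu1 H1 = 1%E & mu2 H2 = 1%E] /\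
    T1 @` H1 `<=` H1 /\ T2 @` H2 `<=` H2 /\
    set_bij H1 H2 phi /\
    (forall A, measurable A -> A `<=` H1 ->
       measurable (phi @` A) /\ mu2 (phi @` A) = mu1 A) /\
    (forall B, measurable B -> B `<=` H2 -> measurable (H1 `&` phi @^-1` B)) /\
    (forall x, H1 x -> phi (T1 x) = T2 (phi x)).

Definition seqsp (N : nat) := int -> 'I_N.+1.

Definition cylinder (N n : nat) (i : 'I_n -> int) (A : 'I_n -> set 'I_N.+1)
  : set (seqsp N) := [set m | forall j, A j (m (i j))].

Definition cylinders (N : nat) : set (set (seqsp N)) :=
  [set C | exists n (i : 'I_n -> int) (A : 'I_n -> set 'I_N.+1), C = cylinder i A].

Definition seqmeas (N : nat) : measurableType ((@cylinders N).-sigma)%mdisp :=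
  g_sigma_algebraType (@cylinders N).

Definition left_shift (N : nat) (m : seqmeas N) : seqmeas N := fun t => m (t + 1).

Definition is_process (d : measure_display) (Omega : measurableType d)
  (N : nat) (Z : int -> Omega -> 'I_N.+1) : Prop :=
  forall t (A : set 'I_N.+1), measurable (Z t @^-1` A).

Definition pevent (d : measure_display) (Omega : measurableType d) (N n : nat)
  (Z : int -> Omega -> 'I_N.+1) (i : 'I_n -> int) (A : 'I_n -> set 'I_N.+1)
  : set Omega := [set w | forall j, A j (Z (i j) w)].

Definition det_rep_measure (d : measure_display) (Omega : measurableType d)
  (P : probability Omega R) (N : nat) (Z : int -> Omega -> 'I_N.+1)
  (mu2 : probability (seqmeas N) R) : Prop :=
  forall n (i : 'I_n -> int) (A : 'I_n -> set 'I_N.+1),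
    mu2 (cylinder i A) = P (pevent Z i A).

Definition prob (d : measure_display) (Omega : measurableType d)
  (P : probability Omega R) (A : set Omega) : R := fine (P A).

Definition bernoulli_process (d : measure_display) (Omega : measurableType d)
  (P : probability Omega R) (N : nat) (Z : int -> Omega -> 'I_N.+1)
  (p : 'I_N.+1 -> R) : Prop :=
  is_process Z /\
  (forall t k, P (Z t @^-1` [set k]) = (p k)%:E) /\
  (forall n (i : 'I_n -> int) (A : 'I_n -> set 'I_N.+1), injective i ->
     prob P (pevent Z i A) = \prod_(j < n) prob P (Z (i j) @^-1` A j)).

Definition bernoulli_system (d : measure_display) (M : measurableType d)
  (mu : probability M R) (T : M -> M) : Prop :=
  measure_preserving_system mu T /\
  exists (dO : measure_display) (Omega : measurableType dO)
         (P : probability Omega R) (N : nat) (Z : int -> Omega -> 'I_N.+1)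
         (p : 'I_N.+1 -> R) (mu2 : probability (seqmeas N) R)
         (phi : M -> seqmeas N),
    bernoulli_process P Z p /\ det_rep_measure P Z mu2 /\
    isomorphic_via mu T mu2 (@left_shift N) phi.

Definition condprob (d : measure_display) (Omega : measurableType d)
  (P : probability Omega R) (A B : set Omega) : R :=
  prob P (A `&` B) / prob P B.

Definition stationary (d : measure_display) (Omega : measurableType d)
  (P : probability Omega R) (N : nat) (Z : int -> Omega -> 'I_N.+1) : Prop :=
  forall n (i : 'I_n -> int) (A : 'I_n -> set 'I_N.+1) (h : int),
    P (pevent Z (fun j => i j + h) A) = P (pevent Z i A).

Definition path_event (d : measure_display) (Omega : measurableType d)
  (N : nat) (Z : int -> Omega -> 'I_N.+1) (k t : int) (a : int -> 'I_N.+1)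
  : set Omega := [set w | forall u : int, k <= u <= t -> Z u w = a u].

(* Markov property, stated with elementary conditional probabilities on the
   (positive-probability) atoms of the finite-valued conditioning variables *)
Definition markov_process (d : measure_display) (Omega : measurableType d)
  (P : probability Omega R) (N : nat) (Z : int -> Omega -> 'I_N.+1) : Prop :=
  is_process Z /\ stationary P Z /\
  forall (t k : int) (a : int -> 'I_N.+1) (b : 'I_N.+1), k <= t ->
    0 < prob P (path_event Z k t a) ->
    condprob P (Z (t + 1) @^-1` [set b]) (path_event Z k t a) =
    condprob P (Z (t + 1) @^-1` [set b]) (Z t @^-1` [set a t]).

(* P^k(s_i, s_j) = P{Z_{n+k} = s_i | Z_n = s_j} (independent of n by
   stationarity; we take n = 0) *)
Definition transition_k (d : measure_display) (Omega : measurableType d)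
  (P : probability Omega R) (N : nat) (Z : int -> Omega -> 'I_N.+1)
  (k : nat) (i j : 'I_N.+1) : R :=
  condprob P (Z (k%:Z) @^-1` [set i]) (Z 0 @^-1` [set j]).

Definition irreducible (d : measure_display) (Omega : measurableType d)
  (P : probability Omega R) (N : nat) (Z : int -> Omega -> 'I_N.+1) : Prop :=
  forall i j : 'I_N.+1, exists k : nat, (0 < k)%N /\ 0 < transition_k P Z k i j.

(* gcd {n >= 1 : P^n(s_i,s_i) > 0} = 1, i.e. 1 is the only common divisor *)
Definition aperiodic (d : measure_display) (Omega : measurableType d)
  (P : probability Omega R) (N : nat) (Z : int -> Omega -> 'I_N.+1) : Prop :=
  forall (i : 'I_N.+1) (c : nat),
    (forall n : nat, (0 < n)%N -> 0 < transition_k P Z n i i -> (c %| n)%N) ->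
    c = 1%N.

(* The Markov process takes the values s_0, ..., s_N in M (s injective);
   its deterministic representation has state space sequences over that
   finite set, encoded through the indices, and Phi_0(m) = s (m 0). *)
Definition eps_congruent (d : measure_display) (M : measurableType d)
  (dist : M -> M -> R) (mu : probability M R) (T : M -> M)
  (N : nat) (s : 'I_N.+1 -> M) (mu2 : probability (seqmeas N) R) (eps : R)
  : Prop :=
  exists phi : M -> seqmeas N,
    isomorphic_via mu T mu2 (@left_shift N) phi /\
    exists2 E : set M, measurable E /\ (mu E < eps%:E)%E &
      forall m, ~ E m -> dist m (s (phi m 0)) < eps.

End Defs.

(* Main.v *)
(* Fix an isomorphism [phi] of the system with a Bernoulli shift, and cover all
   but a small part of [M] by finitely many balls of radius [eps / 2].  Up to a
   small error, the image under [phi] of each ball depends on finitely many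
   coordinates only, say those in [-n, n].  Recoding a sequence [x] by the sliding
   windows (x_(t-n), ..., x_(t+n)) over the symbols of positive probability is
   injective on a full shift-invariant set, and the recoded process is Markov
   because the next window is the present one plus one independent symbol; any
   two windows are joined by a path of every length at least 2n+1, whence
   irreducibility and aperiodicity.  A window tells, up to the error, a ball
   containing the point; it is represented by a point of that ball.  Distinct
   windows need distinct points: either the shift has a single symbol of positive
   probability and there is a single window, or the measure has no atoms and the
   balls of positive measure are infinite. *)
Require Import Defs.
From HB Require Import structures.
From mathcomp Require Import all_boot all_order all_algebra.
From mathcomp Require Import all_classical all_reals all_analysis.
From mathcomp Require Import lra zify.
Set Implicit Arguments.
Unset Strict Implicit.
Unset Printing Implicit Defensive.
Import Order.TTheory GRing.Theory Num.Theory.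
Local Open Scope classical_set_scope.
Local Open Scope ring_scope.

(** * Real-valued probabilities: union bounds and tails of countable unions *)

Section Prob.
Variables (R : realType) (d : measure_display) (T : measurableType d).
Variable P : probability T R.
Implicit Types A B : set T.

Lemma prob_EFin A : measurable A -> P A = (prob P A)%:E.
Proof. by move=> mA; rewrite /prob fineK // fin_num_measure. Qed.

Lemma prob_ge0 A : 0 <= prob P A.
Proof. by apply: fine_ge0; apply: measure_ge0. Qed.

Lemma prob_set0 : prob P set0 = 0.
Proof. by rewrite /prob measure0. Qed.

Lemma le_prob A B : measurable A -> measurable B -> A `<=` B ->
  prob P A <= prob P B.
Proof.
move=> mA mB AB; rewrite -lee_fin -!prob_EFin //.
by apply: le_measure => //; rewrite inE.
Qed.

Lemma prob_setU_le A B : measurable A -> measurable B ->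
  prob P (A `|` B) <= prob P A + prob P B.
Proof.
move=> mA mB; rewrite -lee_fin EFinD -!prob_EFin //; last exact: measurableU.
exact: measureU2.
Qed.

Lemma prob_bigsetU_le n (F : nat -> set T) : (forall i, measurable (F i)) ->
  prob P (\big[setU/set0]_(i < n) F i) <= \sum_(i < n) prob P (F i).
Proof.
move=> mF; elim: n => [|n IH]; first by rewrite !big_ord0 prob_set0.
rewrite !big_ord_recr /=; apply: le_trans (prob_setU_le _ _) _ => //.
  exact: bigsetU_measurable.
by rewrite lerD2r.
Qed.

Lemma prob_bigcup_tail (F : nat -> set T) (e : R) :
  (forall i, measurable (F i)) -> 0 < e ->
  exists n, prob P (\bigcup_i F i `\` \big[setU/set0]_(i < n) F i) <= e.
Proof.
move=> mF e0; pose G n := \big[setU/set0]_(i < n) F i.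
have mG n : measurable (G n) by exact: bigsetU_measurable.
have mU : measurable (\bigcup_i F i) by exact: bigcupT_measurable.
have UG : \bigcup_n G n = \bigcup_i F i.
  apply/seteqP; split => x [n _]; first exact: bigsetU_bigcup.
  by move=> Fx; exists n.+1 => //; rewrite /G -bigcup_mkord; exists n => /=.
have ndG : {homo G : n m / (n <= m)%N >-> (n <= m)%O}.
  by move=> n m nm; rewrite subsetEset; exact: subset_bigsetU.
have mUG : measurable (\bigcup_n G n) by rewrite UG.
have : (P (G n) @[n --> \oo] --> P (\bigcup_i F i))%E.
  by rewrite -UG; exact: nondecreasing_cvg_mu.
rewrite (prob_EFin mU) => /fine_cvgP[_] /cvgrPdist_le /(_ e e0) [n _ /(_ n)].
move=> /(_ (leqnn n)) /= H; exists n.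
have hD : P (\bigcup_i F i `\` G n) = (P (\bigcup_i F i) - P (G n))%E.
  rewrite measureD //; last first.
    by rewrite (le_lt_trans (probability_le1 P mU)) ?ltry.
  by rewrite (setIidr (_ : G n `<=` _)) //; apply: bigsetU_bigcup.
rewrite -lee_fin -(prob_EFin (measurableD mU (mG n))) hD.
rewrite (prob_EFin (mG n)) (prob_EFin mU) -EFinB lee_fin.
by apply: le_trans H; apply: ler_norm.
Qed.
End Prob.

(** * Events depending on finitely many coordinates, and approximation by them *)

Definition determined_by (N : nat) (I : seq int) (C : set (seqsp N)) :=
  forall x y, {in I, x =1 y} -> C x -> C y.

Section Determined.
Variable N : nat.
Implicit Types (C D : set (seqsp N)) (I J : seq int).

Lemma cylinder_determined n (i : 'I_n -> int) (A : 'I_n -> set 'I_N.+1) :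
  determined_by [seq i j | j <- enum 'I_n] (cylinder i A).
Proof.
move=> x y xy Cx j; rewrite -xy; first exact: Cx.
by apply: map_f; rewrite mem_enum.
Qed.

Lemma coord_measurable t (A : set 'I_N.+1) :
  measurable ([set x | A (x t)] : set (seqmeas N)).
Proof.
apply: sub_sigma_algebra; exists 1%N, (fun=> t), (fun=> A).
by apply/seteqP; split => x /= Ax; [move=> _|exact: (Ax ord0)].
Qed.

(** Induction on the list: freezing the value at its head [t] splits [C] into finitely many pieces,
    each a coordinate event intersected with a set determined by the tail. *)
Lemma determined_measurable I C : determined_by I C ->
  measurable (C : set (seqmeas N)).
Proof.
elim: I C => [|t I IH] C hC.
  have [->|/set0P[x Cx]] := eqVneq C set0; first exact: measurable0.
  rewrite (_ : C = setT); first exact: measurableT.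
  by apply/seteqP; split => // y _; apply: (hC x).
pose upd (x : seqsp N) k : seqsp N := fun u => if u == t then k else x u.
have -> : C = \bigcup_(k in [set: 'I_N.+1])
    ([set x | [set k] (x t)] `&` [set x | C (upd x k)]).
  apply/seteqP; split => x.
    move=> Cx; exists (x t) => //; split => //=; apply: hC Cx => u _.
    by rewrite /upd; case: eqP => [->|].
  case=> k _ [/= xk]; apply: hC => u _.
  by rewrite /upd; case: eqP => [->|].
apply: fin_bigcup_measurable => // k _; apply: measurableI.
  exact: coord_measurable.
apply: IH => x y xy; apply: hC => u; rewrite inE /upd; case: eqP => //= _.
exact: xy.
Qed.

Lemma determined_fun_measurable N' (f : seqmeas N -> seqmeas N')
    (I : int -> seq int) :
  (forall t x y, {in I t, x =1 y} -> f x t = f y t) -> measurable_fun setT f.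
Proof.
move=> fI.
refine (@measurability _ _ (seqmeas N) (seqmeas N') setT f (@cylinders N')
  erefl _).
move=> _ [_ [n [i [A ->]]] <-]; rewrite setTI.
apply: (@determined_measurable (flatten [seq I (i j) | j <- enum 'I_n])).
move=> x y xy /= H j; rewrite -(fI _ x y); first exact: H.
move=> u uI; apply: xy; apply/flattenP; exists (I (i j)) => //.
by apply: map_f; rewrite mem_enum.
Qed.

Variable R : realType.

(** The sets approximable in this sense form a sigma-algebra containing the cylinders. *)
Lemma determined_approx (mu : probability (seqmeas N) R) (D : set (seqmeas N)) :
  measurable D -> forall e : R, 0 < e ->
  exists I (C : set (seqsp N)) (B : set (seqmeas N)),
    [/\ determined_by I C, measurable B, prob mu B <= e &
        forall x, ~ B x -> D x <-> C x].
Proof.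
move=> mD; pose app (D : set (seqmeas N)) := measurable D /\
  forall e : R, 0 < e ->
  exists (IC : seq int * set (seqsp N)) (B : set (seqmeas N)),
    [/\ determined_by IC.1 IC.2, measurable B, prob mu B <= e &
        forall x, ~ B x -> D x <-> IC.2 x].
suff /(_ D mD) [_ H] : measurable `<=` app.
  by move=> e /H[[I C] [B h]]; exists I, C, B.
have det0 C I : determined_by I C -> app C.
  move=> hC; split; first exact: determined_measurable hC.
  move=> e e0; exists (I, C), set0; split => //=.
  by rewrite prob_set0 ltW.
have appU (A : nat -> set (seqmeas N)) :
    (forall n, app (A n)) -> app (\bigcup_k A k).
  move=> hA; have mA n : measurable (A n) by case: (hA n).
  split; first exact: bigcupT_measurable.
  (* Half of [e] pays for dropping all but the first [K] sets, the other half is shared among their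
     errors; the divisor [K.+1] is nonzero even if [K = 0]. *)
  move=> e e0; have e20 : 0 < e / 2 by rewrite divr_gt0.
  have [K hK] := prob_bigcup_tail mu mA e20.
  have eK0 : 0 < e / 2 / K.+1%:R by rewrite divr_gt0.
  have /choice[IC /choice[B hB]] := fun n => (hA n).2 _ eK0.
  pose U := \bigcup_i A i `\` \big[setU/set0]_(i < K) A i.
  have mU : measurable U.
    apply: measurableD; first exact: bigcupT_measurable.
    exact: bigsetU_measurable.
  have mB n : measurable (B n) by case: (hB n).
  exists (flatten [seq (IC n).1 | n <- iota 0 K],
    [set x | exists n, (n < K)%N /\ (IC n).2 x]).
  exists (U `|` \big[setU/set0]_(i < K) B i); split => /=.
  + move=> x y xy [n [nK Cx]]; exists n; split => //.
    have [h _ _ _] := hB n; apply: h Cx => u ui; apply: xy.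
    apply/flattenP; exists (IC n).1 => //.
    by apply: map_f; rewrite mem_iota.
  + apply: measurableU => //; exact: bigsetU_measurable.
  + apply: le_trans (prob_setU_le _ mU _) _; first exact: bigsetU_measurable.
    rewrite [leRHS](splitr e); apply: lerD => //.
    apply: le_trans (prob_bigsetU_le _ _ mB) _.
    apply: (@le_trans _ _ (\sum_(i < K) (e / 2 / K.+1%:R))).
      by apply: ler_sum => i _; case: (hB i).
    rewrite sumr_const card_ord -[_ *+ K]mulr_natr -mulrA ger_pMr //.
    by rewrite mulrC ler_pdivrMr ?mul1r ?ler_nat ?ltr0n.
  + move=> x nx; rewrite -bigcup_mkord in nx; split.
      move=> [n _ Anx].
      have [n' n'K An'x] : (\bigcup_(i in `I_K) A i) x.
        apply: contrapT => h; apply: nx; left; rewrite /U -bigcup_mkord.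
        by split => //; exists n.
      exists n'; split => //; have [_ _ _ /(_ x) h] := hB n'.
      by apply/h => // Bx; apply: nx; right; exists n'.
    move=> [n [nK Cx]]; exists n => //.
    have [_ _ _ /(_ x) h] := hB n.
    by apply/h => // Bx; apply: nx; right; exists n.
apply: smallest_sub; last first.
  by move=> _ [n [i [A ->]]]; apply: det0; exact: cylinder_determined.
split.
- by apply: (@det0 set0 [::]) => x y _.
- move=> A [mA hA]; split; first exact: measurableD.
  move=> e /hA[[I C] [B [/= hC mB Be BC]]]; exists (I, ~` C), B; split => //=.
    by move=> x y xy Cx Cy; apply: Cx; apply: hC Cy => u /xy.
  by move=> x /BC h; split => [[_ nA] /h//|nC]; split => // /h.
- exact: appU.
Qed.
End Determined.

(** * Boxes of consecutive coordinates under a product measure *)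

Section Bernoulli.
Variables (R : realType) (N : nat) (mu : probability (seqmeas N) R).
Hypothesis mu_prod : forall n (i : 'I_n -> int) (A : 'I_n -> set 'I_N.+1),
  injective i ->
  prob mu (cylinder i A) = \prod_(j < n) prob mu [set x | A j (x (i j))].

(** [A] is indexed by absolute position, so that constraints coming from windows at different times
    are stated at the coordinate they bear on. *)
Definition box (k : int) (m : nat) (A : int -> set 'I_N.+1) : set (seqmeas N) :=
  [set x | forall j, (j < m)%N -> A (k + j%:Z) (x (k + j%:Z))].

Lemma box_measurable k m A : measurable (box k m A).
Proof.
apply: (@determined_measurable _ [seq k + j%:Z | j <- iota 0 m]).
move=> x y xy h j jm.
rewrite -xy; first exact: h.
by apply: map_f; rewrite mem_iota.
Qed.

Lemma prob_box k m A :
  prob mu (box k m A) =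
  \prod_(j < m) prob mu [set x | A (k + j%:Z) (x (k + j%:Z))].
Proof.
have inj : injective (fun j : 'I_m => k + j%:Z).
  by move=> i j /addrI[] /val_inj.
rewrite -(mu_prod (fun j : 'I_m => A (k + j%:Z)) inj); congr (prob mu _).
apply/seteqP; split => x h j; first exact: h.
by move=> jm; exact: (h (Ordinal jm)).
Qed.

(** Adjoining [E] at position [k + m] gives a box with one more factor. *)
Lemma prob_box_next k m A (E : set 'I_N.+1) :
  prob mu ([set x | E (x (k + m%:Z))] `&` box k m A) =
  prob mu [set x | E (x (k + m%:Z))] * prob mu (box k m A).
Proof.
pose A' s := if s == k + m%:Z then E else A s.
have A'lt j : (j < m)%N -> A' (k + j%:Z) = A (k + j%:Z).
  move=> jm; rewrite /A'; case: eqP => // /addrI[] jE.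
  by rewrite jE ltnn in jm.
have A'm : A' (k + m%:Z) = E by rewrite /A' eqxx.
have -> : [set x : seqmeas N | E (x (k + m%:Z))] `&` box k m A = box k m.+1 A'.
  apply/seteqP; split => x.
    move=> [Ex bx] j; rewrite ltnS leq_eqVlt => /orP[/eqP->|jm].
      by rewrite A'm.
    by rewrite A'lt //; exact: bx.
  move=> h; split; first by have := h m (ltnSn m); rewrite A'm.
  by move=> j jm; rewrite -A'lt //; apply: h; exact: ltnW.
rewrite prob_box big_ord_recr /= A'm mulrC prob_box; congr (_ * _).
by apply: eq_bigr => j _; rewrite A'lt.
Qed.

(** A point lies in boxes of every length [m], of measure at most [r ^+ m]. *)
Lemma prob_set1_eq0 (r : R) : r < 1 ->
  (forall (t : int) (k : 'I_N.+1), prob mu [set x | x t = k] <= r) ->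
  forall x : seqmeas N, measurable [set x] /\ prob mu [set x] = 0.
Proof.
move=> r1 hr x; have mx : measurable [set x].
  rewrite (_ : [set x] = \bigcap_k \bigcap_(s in [set k%:Z; - k%:Z])
      [set y | y s = x s]); last first.
    apply/seteqP; split => [y -> //|y h]; apply: funext => s.
    by apply: (h `|s|%N) => //=; case: (lerP 0 s) => s0; [left|right]; lia.
  apply: bigcapT_measurable => k; apply: fin_bigcap_measurable => // s _.
  by apply: (coord_measurable s [set x s]).
split => //; apply/eqP; rewrite eq_le prob_ge0 andbT leNgt; apply/negP => h0.
have r0 : 0 <= r by apply: le_trans (hr 0 ord0); exact: prob_ge0.
have le_r m : prob mu [set x] <= r ^+ m.
  apply: (@le_trans _ _ (prob mu (box 0 m (fun s => [set x s])))).
    apply: le_prob => //; first exact: box_measurable.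
    by move=> y -> j _.
  rewrite prob_box -[leRHS](_ : \prod_(j < m) r = _).
    by apply: ler_prod => j _; rewrite prob_ge0; exact: hr.
  by rewrite prodr_const card_ord.
have := @cvg_expr R r; rewrite ger0_norm // => /(_ r1) /cvgrPdist_lt.
move=> /(_ _ h0) [m _ /(_ m (leqnn m))] /=.
by rewrite sub0r normrN ger0_norm ?exprn_ge0 // ltNge le_r.
Qed.


(** * The sliding-window process: Markov property, irreducibility, aperiodicity *)

Section Coding.
Variables (S : finType) (c : 'I_N.+1 -> S).
Hypothesis c_pos : forall s t, 0 < prob mu [set x | c (x t) = s].
Hypothesis mu_shift : forall (C : set (seqmeas N)) (h : int), measurable C ->
  mu [set x | C (fun t => x (t + h))] = mu C.
Variables n N' : nat.
Let L := n.*2.+1.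
Local Notation W := {ffun 'I_L -> S}.
Variables (enc : W -> 'I_N'.+1) (dec : 'I_N'.+1 -> W).
Hypotheses (encK : cancel enc dec) (decK : cancel dec enc).

(** The window at [t] is centred: its [L = 2n+1] coordinates run from [t-n] to [t+n]. [enc] numbers
    the windows, outcome spaces being ordinals. *)
Definition coding (x : seqmeas N) : seqmeas N' :=
  fun t => enc [ffun j : 'I_L => c (x (t - n%:Z + j%:Z))].

Let Z t x := coding x t.

Lemma codingP x t b : coding x t = b <->
  forall j : 'I_L, c (x (t - n%:Z + j%:Z)) = dec b j.
Proof.
split => [<- j|h]; first by rewrite encK ffunE.
by rewrite /coding -[b]decK; congr enc; apply/ffunP => j; rewrite ffunE.
Qed.

Lemma coding_determined t x y :
  {in [seq t - n%:Z + j%:Z | j <- iota 0 L], x =1 y} -> coding x t = coding y t.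
Proof.
move=> xy; congr enc; apply/ffunP => j; rewrite !ffunE xy //.
by apply/mapP; exists (val j) => //; rewrite mem_iota /= add0n ltn_ord.
Qed.

Lemma coding_measurable : measurable_fun setT coding.
Proof. by apply: determined_fun_measurable coding_determined. Qed.

Lemma coding_shift x h :
  coding (fun t => x (t + h)) = fun t => coding x (t + h).
Proof.
apply: funext => t; congr enc; apply/ffunP => j; rewrite !ffunE.
by congr (c (x _)); lia.
Qed.

Lemma coding_process : is_process Z.
Proof.
move=> t A.
apply: (@determined_measurable _ [seq t - n%:Z + j%:Z | j <- iota 0 L]).
by move=> x y /coding_determined; rewrite /preimage /Z /= => ->.
Qed.

Lemma coding_stationary : stationary mu Z.
Proof.
move=> m i A h; have mZ : measurable (pevent Z i A).
  rewrite (_ : pevent Z i A = \bigcap_(j in [set: 'I_m]) (Z (i j) @^-1` A j)).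
    by apply: fin_bigcap_measurable => // j _; exact: coding_process.
  by apply/seteqP; split => x /= H j; [move=> _|]; exact: H.
rewrite -(mu_shift h mZ); congr (mu _).
by apply/seteqP; split => x H j; have := H j; rewrite /Z coding_shift.
Qed.

(** The edges of the de Bruijn graph on words of length [L]. *)
Definition successor_compatible (a b : W) :=
  forall i j : 'I_L, i = j.+1 :> nat -> b j = a i.

Lemma coding_next x t a b : coding x t = a -> coding x (t + 1) = b <->
  successor_compatible (dec a) (dec b) /\
  c (x (t - n%:Z + L%:Z)) = dec b ord_max.
Proof.
move=> /codingP xa; split.
  move=> /codingP xb; split.
    by move=> i j ij; rewrite -xa -xb; congr (c (x _)); lia.
  by rewrite -xb; congr (c (x _)); rewrite /= /L; lia.
move=> [ab xe]; apply/codingP => j.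
have [jL|jL] := ltnP j.+1 L.
  by rewrite (ab (Ordinal jL)) // -xa; congr (c (x _)); rewrite /=; lia.
have -> : j = ord_max by apply: val_inj => /=; have := ltn_ord j; lia.
by rewrite -xe; congr (c (x _)); rewrite /= /L; lia.
Qed.

(* The path event and the event [Z t = a] are both boxes ending just before the
   coordinate [t - n + L], so this computes both sides of the Markov property. *)
Lemma condprob_coding_next t k m A a b : k + m%:Z = t - n%:Z + L%:Z ->
  box k m A `<=` [set x | coding x t = a] -> 0 < prob mu (box k m A) ->
  condprob mu (Z (t + 1) @^-1` [set b]) (box k m A) =
  if `[< successor_compatible (dec a) (dec b) >]
  then prob mu [set x | c (x (t - n%:Z + L%:Z)) = dec b ord_max] else 0.
Proof.
move=> kmt boxa box0; rewrite /condprob; case: asboolP => ab.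
  have -> : Z (t + 1) @^-1` [set b] `&` box k m A =
      [set x | [set v | c v = dec b ord_max] (x (k + m%:Z))] `&` box k m A.
    rewrite kmt; apply/seteqP; split => x [/= h bx]; split => //.
      by have [/(_ h)[]] := coding_next b (boxa _ bx).
    by apply/(coding_next b (boxa _ bx)).
  by rewrite prob_box_next mulfK ?gt_eqF // kmt.
rewrite (_ : _ `&` _ = set0) ?prob_set0 ?mul0r //.
apply/seteqP; split => // x [/= h bx].
by have [/(_ h)[]] := coding_next b (boxa _ bx).
Qed.

(** The incoming symbol is independent of the path and of its last window alike, so
    [condprob_coding_next] gives both sides the same value. *)
Lemma coding_markov : markov_process mu Z.
Proof.
split; first exact: coding_process.
split; first exact: coding_stationary.
move=> t k a b kt.
(* At [s] the box collects the constraints of all windows at times [k] to [t] that contain [s];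
   incompatible windows make it empty. *)
have CE : path_event Z k t a = box (k - n%:Z) (absz (t - k)%R + L) (fun s =>
    [set v | forall u (j : 'I_L), k <= u <= t -> u - n%:Z + j%:Z = s ->
             c v = dec (a u) j]).
  apply/seteqP; split => x.
    by move=> h i _ u j /h /codingP H <-; exact: H.
  move=> h u kut; apply/codingP => j.
  have [i iE] : exists i : nat, u - n%:Z + j%:Z = k - n%:Z + i%:Z.
    by exists (absz (u + j%:Z - k)%R); lia.
  by rewrite iE; apply: h => //; have := ltn_ord j; lia.
have DE : Z t @^-1` [set a t] = box (t - n%:Z) L (fun s =>
    [set v | forall j : 'I_L, t - n%:Z + j%:Z = s -> c v = dec (a t) j]).
  apply/seteqP; split => x.
    by move=> /codingP h i _ j <-; exact: h.
  by move=> h; apply/codingP => j; apply: h.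
have CD : path_event Z k t a `<=` Z t @^-1` [set a t].
  by move=> x; apply; rewrite kt lexx.
rewrite CE DE in CD * => C0.
have D0 := lt_le_trans C0
  (le_prob mu (box_measurable _ _ _) (box_measurable _ _ _) CD).
have DS : box (t - n%:Z) L (fun s =>
    [set v | forall j : 'I_L, t - n%:Z + j%:Z = s -> c v = dec (a t) j])
   `<=` [set x | coding x t = a t] by rewrite -DE.
rewrite !(@condprob_coding_next t _ _ _ (a t)) //.
- by lia.
- exact: subset_trans CD DS.
Qed.

Lemma prob_box_gt0 (y : int -> S) k m :
  0 < prob mu (box k m (fun s => [set v | c v = y s])).
Proof. by rewrite prob_box; apply: prodr_gt0 => j _; exact: c_pos. Qed.

(** For [k] at least [L] the windows at times [0] and [k] are disjoint, so their contents can be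
    prescribed freely. *)
Lemma transition_gt0 k i j : (L <= k)%N -> 0 < transition_k mu Z k i j.
Proof.
move=> Lk.
(* [y] spells [j] on the window at [0] and [i] on the one at [k]; its values in between are
   arbitrary, every symbol of [S] having positive probability. *)
pose y s := if s + n%:Z < L%:Z then dec j (inord (absz (s + n%:Z)%R))
            else dec i (inord (absz (s + n%:Z - k%:Z)%R)).
set B := box (- n%:Z) (k + L)%N (fun s => [set v | c v = y s]).
have sB : B `<=` Z k%:Z @^-1` [set i] `&` Z 0 @^-1` [set j].
  move=> x h; split; apply/codingP => l; have lL := ltn_ord l.
    have -> : k%:Z - n%:Z + l%:Z = - n%:Z + (k + l)%N%:Z by lia.
    rewrite h ?ltn_add2l // /y ifF; last by lia.
    congr (dec i _); apply: val_inj; rewrite /= inordK; lia.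
  rewrite sub0r h; last by lia.
  rewrite /y ifT; last by lia.
  congr (dec j _); apply: val_inj; rewrite /= inordK; lia.
have m0 : measurable (Z 0 @^-1` [set j]) by exact: coding_process.
have mk : measurable (Z k%:Z @^-1` [set i]) by exact: coding_process.
have B0 : 0 < prob mu B by exact: prob_box_gt0.
have mB : measurable B by exact: box_measurable.
apply: divr_gt0; apply: lt_le_trans B0 _; apply: le_prob => //.
  exact: measurableI.
by move=> x /sB[].
Qed.

Lemma coding_irreducible : irreducible mu Z.
Proof. by move=> i j; exists L; split => //; exact: transition_gt0. Qed.

(** Both [L] and [L + 1] are return times, so a common divisor divides [1]. *)
Lemma coding_aperiodic : aperiodic mu Z.
Proof.
move=> i e h; apply/eqP; rewrite -dvdn1.
have eL : (e %| L)%N by apply: h => //; exact: transition_gt0.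
by rewrite -(dvdn_addr 1 eL) addn1; apply: h => //; exact: transition_gt0.
Qed.
End Coding.
End Bernoulli.

(** * Transport of measure and invariance along an isomorphism *)

Lemma measure_setI_full (R : realType) (d : measure_display)
    (T : measurableType d) (P : probability T R) (A H : set T) :
  measurable A -> measurable H -> P H = 1%E -> P (A `&` H) = P A.
Proof.
move=> mA mH H1; have mD : measurable (A `\` H) by exact: measurableD.
have D0 : P (A `\` H) = 0%E.
  have mC : measurable (~` H) by exact: measurableC.
  apply: (subset_measure0 mD mC); first by move=> x [].
  by apply: (etrans (probability_setC P mH)); rewrite H1 subee.
have E : P A = (P (A `\` H) + P (A `&` H))%E := measureDI P mA mH.
by rewrite E D0 add0e.
Qed.

Lemma measure_system_preimage (R : realType) (d : measure_display)
    (M : measurableType d) (mu : probability M R) (T : M -> M) :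
  measure_preserving_system mu T -> forall A, measurable A ->
  measurable (T @^-1` A) /\ mu (T @^-1` A) = mu A.
Proof.
move=> [Ti [TK [TiK [mT [mTi muT]]]]] A mA.
have mTA : measurable (T @^-1` A) by rewrite -[_ @^-1` _]setTI; exact: mT.
split => //; rewrite -muT //; congr (mu _).
apply/seteqP; split => [_ [x Ax <-] //|x Ax].
by exists (Ti x) => //=; rewrite TiK.
Qed.

Section Isomorphism.
Variables (R : realType) (d1 d2 : measure_display).
Variables (M1 : measurableType d1) (M2 : measurableType d2).
Variables (mu1 : probability M1 R) (T1 : M1 -> M1).
Variables (mu2 : probability M2 R) (T2 : M2 -> M2) (phi : M1 -> M2).
Variables (H1 : set M1) (H2 : set M2).
Hypotheses (mH1 : measurable H1) (mH2 : measurable H2).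
Hypotheses (mu1H1 : mu1 H1 = 1%E) (mu2H2 : mu2 H2 = 1%E).
Hypothesis T1H1 : T1 @` H1 `<=` H1.
Hypothesis T2H2 : T2 @` H2 `<=` H2.
Hypothesis phi_bij : set_bij H1 H2 phi.
Hypothesis phi_image : forall A, measurable A -> A `<=` H1 ->
  measurable (phi @` A) /\ mu2 (phi @` A) = mu1 A.
Hypothesis phi_preimage : forall B, measurable B -> B `<=` H2 ->
  measurable (H1 `&` phi @^-1` B).
Hypothesis phi_comm : forall x, H1 x -> phi (T1 x) = T2 (phi x).

Lemma measure_iso_preimage C : measurable C ->
  measurable (H1 `&` phi @^-1` C) /\ mu1 (H1 `&` phi @^-1` C) = mu2 C.
Proof.
move=> mC; have [/= phiH12 _ surj] := phi_bij.
have E : H1 `&` phi @^-1` C = H1 `&` phi @^-1` (C `&` H2).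
  apply/seteqP; split => x [Hx]; last by case.
  by move=> Cx; split => //; split => //; exact: phiH12.
have mE : measurable (H1 `&` phi @^-1` C).
  by rewrite E; apply: phi_preimage; [exact: measurableI|move=> x []].
split => //; rewrite -(phi_image mE _).2; last by move=> x [].
rewrite -(measure_setI_full mC mH2 mu2H2); congr (mu2 _).
apply/seteqP; split => [_ [x [Hx Cx] <-]|y [Cy Hy]].
  by split => //; exact: phiH12.
by have [x Hx xy] := surj _ Hy; exists x => //; split => //=; rewrite xy.
Qed.

(** Yields the shift-invariance of the Bernoulli measure from that of [mu] under [T], pulling events
    back through [phi]. *)
Lemma iso_invariant :
  measure_preserving_system mu1 T1 -> measurable_fun setT T2 ->
  forall C, measurable C -> mu2 (T2 @^-1` C) = mu2 C.
Proof.
move=> mpT mT2 C mC.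
have mTC : measurable (T2 @^-1` C) by rewrite -[_ @^-1` _]setTI; exact: mT2.
have [mE <-] := measure_iso_preimage mTC.
have [mF <-] := measure_iso_preimage mC.
have [mTF <-] := measure_system_preimage mpT mF.
rewrite -(measure_setI_full mTF mH1 mu1H1); congr (mu1 _).
apply/seteqP; split => x.
  move=> [Hx]; rewrite /= -phi_comm // => Cx; split => //; split => //.
  by apply: T1H1; exists x.
by move=> [[/= _ Cx] Hx]; split => //=; rewrite -phi_comm.
Qed.

(* [Th] is a left inverse of [F] on [G] only; measurability of the fixed points of
   [F \o Th] is what makes [F] preserve measurability of images. *)
Lemma isomorphic_via_comp (d3 : measure_display) (M3 : measurableType d3)
    (mu3 : probability M3 R) (T3 : M3 -> M3) (F : M2 -> M3) (Th : M3 -> M2)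
    (G : set M2) :
  measurable G -> mu2 G = 1%E -> T2 @` G `<=` G ->
  measurable_fun setT F -> measurable_fun setT Th ->
  measurable [set y | F (Th y) = y] ->
  (forall B, measurable B -> mu3 B = mu2 (F @^-1` B)) ->
  (forall x, G x -> Th (F x) = x) -> (forall x, F (T2 x) = T3 (F x)) ->
  isomorphic_via mu1 T1 mu3 T3 (F \o phi).
Proof.
move=> mG mu2G T2G mF mTh mFix mu3E ThK FT.
have [/= phiH12 phi_inj phi_surj] := phi_bij.
have F_image B : measurable B -> B `<=` G ->
    measurable (F @` B) /\ mu3 (F @` B) = mu2 B.
  move=> mB BG.
  have E : F @` B = [set y | F (Th y) = y] `&` Th @^-1` B.
    apply/seteqP; split => [_ [x Bx <-]|y [/= yE By]]; last by exists (Th y).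
    by split => /=; rewrite ThK //; exact: BG.
  have mFB : measurable (F @` B).
    rewrite E; apply: measurableI => //.
    by rewrite -[_ @^-1` _]setTI; exact: mTh.
  split => //; rewrite mu3E // -(measure_setI_full _ mG mu2G); last first.
    by rewrite -[_ @^-1` _]setTI; exact: mF.
  congr (mu2 _); apply/seteqP; split => x.
    by move=> [[y By yx] Gx]; rewrite -(ThK _ Gx) -yx ThK //; exact: BG.
  by move=> Bx; split; [exists x|exact: BG].
have mHG : measurable (H2 `&` G) by exact: measurableI.
have HGG : H2 `&` G `<=` G by move=> x [].
have [mFHG mu3FHG] := F_image _ mHG HGG.
have [mpG mu1pG] := measure_iso_preimage mG.
exists (H1 `&` phi @^-1` G), (F @` (H2 `&` G)); split.
  split => //; first by rewrite mu1pG.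
  by rewrite mu3FHG (measure_setI_full mH2 mG).
split.
  move=> _ [x [Hx Gx] <-]; split; first by apply: T1H1; exists x.
  by rewrite /= phi_comm //; apply: T2G; exists (phi x).
split.
  move=> _ [_ [x [Hx Gx] <-] <-]; exists (T2 x); last exact: FT.
  by split; [apply: T2H2|apply: T2G]; exists x.
split.
  split.
  - by move=> x [Hx Gx]; exists (phi x) => //; split => //; exact: phiH12.
  - move=> x y; rewrite !inE => -[Hx Gx] [Hy Gy] /= Fxy.
    apply: phi_inj; rewrite ?inE //.
    by rewrite -(ThK _ Gx) Fxy ThK.
  - move=> _ [x [Hx Gx] <-]; have [z Hz zx] := phi_surj _ Hx.
    by exists z => /=; [split => //=; rewrite zx|rewrite zx].
split.
  move=> A mA AH; have AH1 : A `<=` H1 by move=> x /AH[].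
  have [mpA mupA] := phi_image mA AH1.
  have pAG : phi @` A `<=` G by move=> _ [x /AH[_ Gx] <-].
  by rewrite -image_comp -mupA; exact: F_image.
split.
  move=> B mB BH.
  rewrite (_ : _ `&` _ = H1 `&` phi @^-1` (G `&` F @^-1` B)); last first.
    by apply/seteqP; split => x /=; [move=> [[]]|move=> [? []]].
  apply: (measure_iso_preimage _).1; apply: measurableI => //.
  by rewrite -[_ @^-1` _]setTI; exact: mF.
by move=> x [Hx _] /=; rewrite phi_comm // FT.
Qed.
(** Were [A] contained in [l], its image would be covered by finitely many null points. *)
Lemma iso_positive_notin : (forall y : M2, measurable [set y]) ->
  (forall y : M2, mu2 [set y] = 0%E) ->
  forall A, measurable A -> 0 < prob mu1 A ->
  forall l : seq M1, exists2 x, A x & x \notin l.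
Proof.
move=> m1 mu2_1 A mA A0 l; apply: contrapT => nA.
have Al x : A x -> x \in l.
  by move=> Ax; apply/negPn/negP => xl; apply: nA; exists x.
have mAH : measurable (A `&` H1) by exact: measurableI.
have [mI muI] : measurable (phi @` (A `&` H1)) /\
    mu2 (phi @` (A `&` H1)) = mu1 (A `&` H1).
  exact: phi_image mAH (@subIsetr _ _ _).
have mF k : measurable [set phi (nth point l k)] by exact: m1.
have : prob mu2 (phi @` (A `&` H1)) <=
    prob mu2 (\big[setU/set0]_(k < size l) [set phi (nth point l k)]).
  apply: le_prob => //; first exact: bigsetU_measurable.
  move=> _ [x [/Al xl _] <-].
  rewrite -(bigcup_mkord _ (fun k => [set phi (nth point l k)])).
  by exists (index x l); rewrite /= ?index_mem // nth_index.
move=> /le_trans /(_ (prob_bigsetU_le mu2 (size l) mF)).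
rewrite big1; last by move=> k _; rewrite /prob mu2_1.
by rewrite /prob muI (measure_setI_full (A := A) (H := H1)) // leNgt => /negP.
Qed.
End Isomorphism.

(** The image of [B] is approximated, and the result pulled back through [phi]. The last clause
    ensures that a ball announced by a window has positive measure. *)
Lemma iso_determined_approx (R : realType) (d : measure_display)
    (M : measurableType d) (mu : probability M R) (N : nat)
    (nu : probability (seqmeas N) R) (phi : M -> seqmeas N)
    (H1 : set M) (H2 : set (seqmeas N)) :
  measurable H1 -> measurable H2 -> nu H2 = 1%E -> set_bij H1 H2 phi ->
  (forall A, measurable A -> A `<=` H1 ->
    measurable (phi @` A) /\ nu (phi @` A) = mu A) ->
  (forall B, measurable B -> B `<=` H2 -> measurable (H1 `&` phi @^-1` B)) ->
  forall B (e : R), measurable B -> 0 < e ->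
  exists ICE : seq int * set (seqsp N) * set M,
    [/\ determined_by ICE.1.1 ICE.1.2, measurable ICE.2,
        prob mu ICE.2 <= e,
        forall m, H1 m -> ~ ICE.2 m -> B m <-> ICE.1.2 (phi m) &
        (exists x, ICE.1.2 x) -> 0 < prob mu B].
Proof.
move=> mH1 mH2 nuH2 bij img pre B e mB e0.
(* A null [B] gets the empty approximation, with [B] itself as exceptional set, which makes the last
   clause vacuous. *)
have [B0|/negP B0] := boolP (0 < prob mu B); last first.
  exists ([::], set0, B); split => //=.
  - by apply: le_trans (ltW e0); rewrite leNgt; apply/negP.
  - by move=> [].
have mBH : measurable (B `&` H1) by exact: measurableI.
have [mD _] : measurable (phi @` (B `&` H1)) /\ _ :=
  img _ mBH (@subIsetr _ _ _).
have [I [C [D [hI mDD De DC]]]] := determined_approx nu mD e0.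
have [mE muE] := measure_iso_preimage mH2 nuH2 bij img pre mDD.
exists (I, C, H1 `&` phi @^-1` D); split => //=; first by rewrite /prob muE.
move=> m Hm nD; rewrite -DC; last by move=> Dm; apply: nD.
split => [Bm|[m' [Bm' Hm'] mm']]; first by exists m.
by have [_ inj _] := bij; rewrite -(inj m' m) ?inE.
Qed.

(** * Invariance under translation by any integer *)

Lemma left_shift_measurable N : measurable_fun setT (@left_shift N).
Proof.
apply: (@determined_fun_measurable _ _ _ (fun t => [:: t + 1])) => t x y.
by apply; rewrite inE.
Qed.

Lemma shift_invariant_int (R : realType) N (mu : probability (seqmeas N) R) :
  (forall C, measurable C -> mu (@left_shift N @^-1` C) = mu C) ->
  forall (C : set (seqmeas N)) (h : int), measurable C ->
  mu [set x | C (fun t => x (t + h))] = mu C.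
Proof.
move=> inv.
have mS (C : set (seqmeas N)) h : measurable C ->
    measurable ([set x | C (fun t => x (t + h))] : set (seqmeas N)).
  move=> mC; rewrite -[X in measurable X]setTI.
  apply: (@determined_fun_measurable _ _ (fun x t => x (t + h))
    (fun t => [:: t + h])) => // t x y.
  by apply; rewrite inE.
have pos (h : nat) (C : set (seqmeas N)) : measurable C ->
    mu [set x | C (fun t => x (t + h%:Z))] = mu C.
  move=> mC; elim: h => [|h IH].
    by congr (mu _); apply/seteqP; split => x;
      rewrite /= (_ : (fun t => _) = x) //;
      apply: funext => t; rewrite addr0.
  rewrite -IH -[RHS]inv; last exact: mS.
  congr (mu _); apply/seteqP; split => x /=; rewrite /left_shift => Cx;
    congr C: Cx; apply: funext => t; congr x; lia.
move=> C [h|h] mC; first exact: pos.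
(* The offset is [-(h+1)]: translating the event by [h+1] gives back [C]. *)
rewrite -(pos h.+1); last exact: mS.
congr (mu _); apply/seteqP; split => x /= Cx; [congr C: Cx|congr C: Cx];
  apply: funext => t; congr x; lia.
Qed.

(** * Support and degeneracy of the one-coordinate marginals *)

Section Marginals.
Variables (R : realType) (N : nat) (mu : probability (seqmeas N) R).
Variable p : 'I_N.+1 -> R.
Hypothesis mu_coord : forall (t : int) (k : 'I_N.+1),
  mu [set x | x t = k] = (p k)%:E.

Lemma prob_coord (t : int) (k : 'I_N.+1) : prob mu [set x | x t = k] = p k.
Proof. by rewrite /prob mu_coord. Qed.

Lemma marginal_ge0 k : 0 <= p k.
Proof. by rewrite -(prob_coord 0); exact: prob_ge0. Qed.

(** The complement is a countable union of null events, over the pairs of a time and a symbol of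
    probability zero; [pickle] enumerates them. *)
Lemma support_full (G := [set x : seqmeas N | forall t, 0 < p (x t)]) :
  measurable G /\ mu G = 1%E.
Proof.
pose F i : set (seqmeas N) :=
  [set x | exists t, unpickle i = Some (t, x t) /\ ~ 0 < p (x t)].
have F0 i : measurable (F i) /\ mu (F i) = 0%E.
  have [[[t k] ik]|nik] : (exists tk : int * 'I_N.+1, unpickle i = Some tk) \/
      (unpickle i = None :> option (int * 'I_N.+1)).
    by case: (unpickle i) => [tk|]; [left; exists tk|right].
  have [pk|pk] := pselect (0 < p k).
    suff -> : F i = set0 by split => //; exact: measure0.
    by apply/seteqP; split => // x [u []]; rewrite ik => -[_ <-].
  have -> : F i = [set x | [set k] (x t)].
    apply/seteqP; split => x; first by move=> [u []]; rewrite ik => -[-> ->].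
    by move=> /= xk; exists t; rewrite xk ik.
  split; first exact: (coord_measurable t [set k]).
  rewrite [LHS](mu_coord t k); congr (_%:E); apply/eqP.
  by rewrite eq_le marginal_ge0 leNgt andbT; apply/negP.
suff -> : F i = set0 by split => //; exact: measure0.
by apply/seteqP; split => // x [t []]; rewrite nik.
have -> : G = ~` \bigcup_i F i.
  apply/seteqP; split => x; first by move=> Gx [i _ [t []]] _; apply.
  move=> nF t; apply: contrapT => h; apply: nF.
  by exists (pickle (t, x t)) => //; exists t; rewrite pickleK.
have mF : measurable (\bigcup_i F i).
  by apply: bigcupT_measurable => i; exact: (F0 i).1.
split; first exact: measurableC.
have neg : mu.-negligible (\bigcup_i F i).
  by apply: negligible_bigcup => i; apply/negligibleP; have [] := F0 i.
rewrite probability_setC // (_ : mu (\bigcup_i F i) = 0%E) ?sube0 //.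
exact: (negligibleP mu mF).1.
Qed.

Lemma marginal_add_le1 k k' : k != k' -> p k + p k' <= 1.
Proof.
move=> kk'; rewrite -!(prob_coord 0) -lee_fin EFinD.
have m j : measurable [set x : seqmeas N | x 0 = j].
  exact: (coord_measurable 0 [set j]).
rewrite -!prob_EFin // -measureU //.
  by apply: probability_le1; exact: measurableU.
by apply/seteqP; split => // x [/= -> /eqP]; rewrite (negbTE kk').
Qed.

Lemma marginal_degenerate :
  #|[set k | 0 < p k]%SET| = 1%N \/
  exists2 r, r < 1 & forall k, p k <= r.
Proof.
have [k pk] : exists k, 0 < p k.
  have [_ G1] := support_full; apply: contrapT => nk.
  move: G1; rewrite (_ : [set x : seqmeas N | forall t, 0 < p (x t)] = set0).
    by rewrite measure0 => -[] /esym/eqP; rewrite oner_eq0.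
  by apply/seteqP; split => // x /(_ 0) h; apply: nk; exists (x 0).
have [[k' kk' pk']|all0] := pselect (exists2 k', k' != k & 0 < p k').
  (* With two symbols of positive probability, every [j] differs from one of them, so [p j < 1]. *)
  right; exists (\big[Order.max/0]_j p j); last by move=> j; exact: le_bigmax.
  apply: bigmax_lt => // j _; have [->|jk] := eqVneq j k.
    by have := marginal_add_le1 kk'; lra.
  by have := marginal_add_le1 jk; lra.
left; apply/eqP/cards1P; exists k; apply/setP => j; rewrite !inE.
apply/idP/eqP => [pj|-> //]; apply/eqP/negPn/negP => jk.
by apply: all0; exists j.
Qed.
End Marginals.

(** * The law of a Bernoulli shift read off its process *)

Section BernoulliRepresentation.
Variables (R : realType) (d : measure_display) (Omega : measurableType d).
Variables (P : probability Omega R) (N : nat) (Z : int -> Omega -> 'I_N.+1).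
Variables (p : 'I_N.+1 -> R) (mu2 : probability (seqmeas N) R).
Hypotheses (bern : bernoulli_process P Z p) (rep : det_rep_measure P Z mu2).

Lemma det_rep_coord t (A : set 'I_N.+1) :
  mu2 [set x | A (x t)] = P (Z t @^-1` A).
Proof.
have := rep (fun _ : 'I_1 => t) (fun _ => A).
rewrite (_ : cylinder _ _ = [set x | A (x t)]); last first.
  by apply/seteqP; split => x /= h; [exact: (h ord0)|].
by move=> ->; congr (P _); apply/seteqP; split => x /= h; [exact: (h ord0)|].
Qed.

Lemma bernoulli_coord (t : int) (k : 'I_N.+1) :
  mu2 [set x | x t = k] = (p k)%:E.
Proof. by rewrite -(bern.2.1 t) -(det_rep_coord t [set k]). Qed.

Lemma bernoulli_cylinder n (i : 'I_n -> int) (A : 'I_n -> set 'I_N.+1) :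
  injective i ->
  prob mu2 (cylinder i A) = \prod_(j < n) prob mu2 [set x | A j (x (i j))].
Proof.
move=> inji; rewrite /prob rep [LHS](bern.2.2 _ _ _ inji).
by apply: eq_bigr => j _; rewrite det_rep_coord.
Qed.
End BernoulliRepresentation.

(** * Covering by finitely many balls and choosing distinct representatives *)

Lemma separable_ball_cover (R : realType) (d : measure_display)
    (M : measurableType d) (dist : M -> M -> R) (mu : probability M R) :
  is_metric dist -> separable_metric dist ->
  (forall (x : M) (r : R), 0 < r -> measurable (open_ball dist x r)) ->
  forall r e : R, 0 < r -> 0 < e ->
  exists (x : nat -> M) (K : nat),
    prob mu (~` \big[setU/set0]_(i < K) open_ball dist (x i) r) <= e.
Proof.
move=> [_ [_ [dist_sym _]]] [D [/countable_injP[f finj] dense]] mball r e r0 e0.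
(* Indices missed by [f] get the default [point]; the extra balls are harmless. *)
pose x i := xget point [set y | D y /\ f y = i].
have xf y : D y -> x (f y) = y.
  move=> Dy; apply: xget_unique => //= z [Dz fz].
  by apply: finj; rewrite ?inE.
exists x.
have mB i : measurable (open_ball dist (x i) r) by exact: mball.
have [K hK] := prob_bigcup_tail mu mB e0; exists K.
move: hK; rewrite (_ : \bigcup_i _ = setT) ?setTD //.
apply/seteqP; split => // z _; have [y Dy yz] := dense z r r0.
by exists (f y) => //; rewrite /open_ball /= xf // dist_sym.
Qed.

(** Greedy choice: fewer than [#|W|] points are taken when a new one is picked. The bound on
    [size l] matters when [W] is a singleton: only the empty list must then be avoided. *)
Lemma injective_selection (W : finType) (M : choiceType) (F : W -> set M) :
  (forall w (l : seq M), (size l < #|W|)%N -> exists2 x, F w x & x \notin l) ->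
  exists s : W -> M, injective s /\ forall w, F w (s w).
Proof.
move=> hF.
suff /(_ (enum W)) [||s [inj sF]] : forall r : seq W, uniq r ->
    (size r <= #|W|)%N ->
    exists s : W -> M, {in r &, injective s} /\ {in r, forall w, F w (s w)}.
- exact: enum_uniq.
- by rewrite -cardE.
- exists s; split; first by move=> w w'; apply: inj; rewrite mem_enum.
  by move=> w; apply: sF; rewrite mem_enum.
elim=> [_ _|w r IH /= /andP[wr ur] rW].
  have [[w0]|nW] := pselect (inhabited W); last first.
    by exists (fun w => False_rect _ (nW (inhabits w))).
  have [//|x _ _] := hF w0 [::]; first by apply/card_gt0P; exists w0.
  by exists (fun=> x).
have [s [inj sF]] := IH ur (ltnW rW).
have [|x Fx xs] := hF w (map s r); first by rewrite size_map.
exists (fun w' => if w' == w then x else s w'); split.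
  move=> a b; rewrite !inE; have [->|aw] := eqVneq a w;
    have [->|bw] := eqVneq b w => //= ha hb.
  - by move=> xsb; move: xs; rewrite xsb map_f.
  - by move=> xsa; move: xs; rewrite -xsa map_f.
  - exact: inj.
move=> a; rewrite inE; case: eqVneq => [-> //|_ /=]; exact: sF.
Qed.

(** * Choice of the code, of the representatives and of the exceptional set *)

Theorem theorem2 (R : realType) (dM : measure_display) (M : measurableType dM)
  (dist : M -> M -> R) (mu : probability M R) (T : M -> M) :
  is_metric dist -> separable_metric dist ->
  (forall (x : M) (r : R), 0 < r -> measurable (open_ball dist x r)) ->
  bernoulli_system mu T ->
  forall eps : R, 0 < eps ->
  exists (N : nat) (s : 'I_N.+1 -> M), injective s /\
  exists (dO : measure_display) (Omega : measurableType dO)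
         (P : probability Omega R) (Z : int -> Omega -> 'I_N.+1),
    markov_process P Z /\ irreducible P Z /\ aperiodic P Z /\
    exists mu2 : probability (seqmeas N) R,
      det_rep_measure P Z mu2 /\ eps_congruent dist mu T s mu2 eps.
Proof.
move=> mdist sdist mball [mpT].
move=> [dO [Om [P [N [Y [p [nu [phi [bernY [repY iso]]]]]]]]]] eps eps0.
have nu_coord := bernoulli_coord bernY repY.
have nu_prod n i A := @bernoulli_cylinder _ _ _ _ _ _ _ _ bernY repY n i A.
case: iso => H1 [H2 [[mH1 mH2 muH1 nuH2] [TH1 [SH2 [bij [img [pre comm]]]]]]].
have nu_pre := measure_iso_preimage mH2 nuH2 bij img pre.
have nu_shift := shift_invariant_int (iso_invariant mH1 mH2 muH1 nuH2 TH1 bij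
  img pre comm mpT (left_shift_measurable (N := N))).
have [mG nuG] := support_full nu_coord.
set G := [set x | _] in mG nuG.
have [x0 Gx0] : exists x, G x.
  apply: contrapT => nG; move: nuG; rewrite (_ : G = set0).
    by rewrite measure0 => -[] /esym/eqP; rewrite oner_eq0.
  by apply/seteqP; split => // x Gx; apply: nG; exists x.
(* Two points of one ball of radius [eps / 2] are less than [eps] apart; [eps / 4] bounds the
   uncovered part, another [eps / 4] the sum of the approximation errors. *)
have [e20 e40] : 0 < eps / 2 /\ 0 < eps / 4 by split; rewrite divr_gt0.
have [z [K hK]] := separable_ball_cover mu mdist sdist mball e20 e40.
pose B i := open_ball dist (z i) (eps / 2).
have mB i : measurable (B i) by exact: mball.
have eK0 : 0 < eps / 4 / K.+1%:R by rewrite divr_gt0.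
have /choice[ICE hICE] i :=
  iso_determined_approx mH1 mH2 nuH2 bij img pre (mB i) eK0.
(* [n] bounds every coordinate used by the approximations, so the window at [0] decides them all. *)
pose n := (\max_(i < K) \max_(t <- (ICE i).1.1) absz t)%N.
have n_ge i t : (i < K)%N -> t \in (ICE i).1.1 -> (absz t <= n)%N.
  move=> iK tI.
  pose m (i : 'I_K) := (\max_(t <- (ICE i).1.1) absz t)%N.
  apply: leq_trans (leq_bigmax (F := m) (Ordinal iK)).
  exact: (leq_bigmax_seq (F := absz)).
pose S : finType := {k : 'I_N.+1 | 0 < p k}.
pose W := {ffun 'I_n.*2.+1 -> S}.
(* Symbols of probability zero are sent to the default [x0 0]; none occurs on [G]. *)
pose c : 'I_N.+1 -> S := insubd (Sub (x0 0) (Gx0 0) : S).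
have cK x t : G x -> val (c (x t)) = x t.
  by move=> Gx; rewrite insubdK //; exact: Gx.
have W0 : (0 < #|{: W}|)%N.
  by apply/card_gt0P; exists [ffun=> c (x0 0)].
pose N' := #|{: W}|.-1.
have N'E : #|{: W}| = N'.+1 by rewrite /N' prednK.
pose enc (w : W) : 'I_N'.+1 := cast_ord N'E (enum_rank w).
pose dec (i : 'I_N'.+1) : W := enum_val (cast_ord (esym N'E) i).
have encK : cancel enc dec by move=> w; rewrite /enc /dec cast_ordK enum_rankK.
have decK : cancel dec enc by move=> i; rewrite /enc /dec enum_valK cast_ordKV.
have c_pos (s : S) (t : int) : 0 < prob nu [set x | c (x t) = s].
  apply: (@lt_le_trans _ _ (p (val s))); first exact: valP s.
  rewrite -(prob_coord nu_coord t); apply: le_prob.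
  - exact: (coord_measurable t [set val s]).
  - exact: (coord_measurable t [set k | c k = s]).
  - by move=> x /= ->; rewrite /c valKd.
pose F := coding c enc.
have mF : measurable_fun setT F by exact: coding_measurable.
pose Fm : {mfun seqmeas N >-> seqmeas N'} :=
  HB.pack F (isMeasurableFun.Build _ _ _ _ F mF).
pose nu' : probability (seqmeas N') R := distribution nu Fm.
(* Reading a window as a sequence; outside [-n, n] the value is irrelevant. *)
pose ext (w : W) : seqsp N := fun t => val (w (inord (absz (t + n%:Z)%R))).
have ext_coding x (I : seq int) : G x ->
    (forall t, t \in I -> (absz t <= n)%N) ->
    {in I, x =1 ext (dec (F x 0))}.
  move=> Gx In t /In tn; rewrite /ext /F /coding encK ffunE.
  rewrite -[LHS](cK _ _ Gx); congr (val (c (x _))).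
  by rewrite inordK; lia.
pose used (i : 'I_N'.+1) l := (l < K)%N /\ (ICE l).1.2 (ext (dec i)).
(* [A i] is a ball announced by the window [i], or the whole space if there is none; its measure is
   positive either way. *)
have /choice[A hA] (i : 'I_N'.+1) : exists A : set M,
    [/\ measurable A, 0 < prob mu A &
    (exists l, used i l) -> exists2 l, used i l & A = B l].
  have [[l ul]|nu_] := pselect (exists l, used i l); last first.
    by exists setT; split => //; rewrite /prob probability_setT.
  exists (B l); split => //; last by exists l.
  by have [_ _ _ _] := hICE l; apply; exists (ext (dec i)); case: ul.
have [|s [s_inj sA]] := @injective_selection _ M A.
  move=> i l sl; have [mA A0 _] := hA i.
  have [y Ay] : exists y, A i y.
    apply: contrapT => nA; move: A0.
    rewrite (_ : A i = set0) ?prob_set0 ?ltxx //.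
    by apply/seteqP; split => // y Ay; apply: nA; exists y.
  (* With one symbol there is one window, hence [l] is empty and any point will do; otherwise no
     point has positive measure. *)
  have [S1|[r r1 pr]] := marginal_degenerate nu_coord.
    exists y => //; suff /size0nil -> : size l = 0%N by [].
    have cS : #|{: S}| = 1%N by rewrite card_sig -S1 cardsE.
    by move: sl; rewrite card_ord -N'E card_ffun cS exp1n ltnS leqn0 => /eqP.
  have pr' (t : int) (k : 'I_N.+1) : prob nu [set x | x t = k] <= r.
    by rewrite (prob_coord nu_coord).
  have nu1 y' := prob_set1_eq0 nu_prod r1 pr' y'.
  apply: (iso_positive_notin mH1 muH1 img _ _ mA A0 l) => y'.
    exact: (nu1 y').1.
  by rewrite prob_EFin ?(nu1 y').2 //; exact: (nu1 y').1.
exists N', s; split => //.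
(* The process lives on the Bernoulli shift itself, so [nu'], the image of [nu] under [F], is its
   law. *)
exists _, (seqmeas N), nu, (fun t x => F x t).
split; first exact (coding_markov nu_prod c nu_shift encK decK).
split; first exact (coding_irreducible nu_prod c_pos encK decK).
split; first exact (coding_aperiodic nu_prod c_pos encK decK).
exists nu'; split; first by [].
exists (F \o phi); split.
  (* [Th] reads the central symbol, at index [n], of each window. *)
  pose Th (y : seqmeas N') : seqmeas N := fun t => val (dec (y t) (inord n)).
  have Th_det t (x y : seqmeas N') : {in [:: t], x =1 y} -> Th x t = Th y t.
    by rewrite /Th => ->; rewrite ?inE.
  apply: (@isomorphic_via_comp _ _ _ _ _ mu T nu (@left_shift N) phi H1 H2
    mH2 nuH2 TH1 SH2 bij img pre comm _ _ nu' (@left_shift N') F Th G) => //.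
  - by move=> _ [x Gx <-] t; exact: Gx.
  - exact: determined_fun_measurable Th_det.
  (* Being a fixed point is checked at each [t] separately, where it involves only [t] and the
     coordinates of the window around it. *)
  - pose J (t : int) := t :: [seq t - n%:Z + j%:Z | j <- iota 0 n.*2.+1].
    have -> : [set y | F (Th y) = y] =
        \bigcap_i \bigcap_(t in [set i%:Z; - i%:Z]) [set y | F (Th y) t = y t].
      apply/seteqP; split => [y /= Fy i _ t _ /=|y h]; first by rewrite Fy.
      apply: funext => t; apply: (h (absz t)) => //=.
      by case: (lerP 0 t) => t0; [left|right]; lia.
    apply: bigcapT_measurable => i; apply: fin_bigcap_measurable => // t _.
    apply: (@determined_measurable _ (J t)) => x y xy /= xE.
    rewrite -xy ?inE ?eqxx // -xE; apply: coding_determined => u uI.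
    by rewrite /Th -xy // /J inE uI orbT.
  - move=> x Gx; apply: funext => t.
    rewrite /Th /F /coding encK ffunE -[RHS](cK _ _ Gx).
    by congr (val (c (x _))); rewrite inordK; lia.
  - by move=> x; exact: (coding_shift c enc x 1).
have [mHG muHG] := nu_pre _ mG.
(* Excluded are the points where the coding may fail, those outside the balls, and the approximation
   errors. *)
pose E1 := ~` (H1 `&` phi @^-1` G).
pose E2 := ~` \big[setU/set0]_(i < K) B i.
pose E3 := \big[setU/set0]_(i < K) (ICE i).2.
have mICE i : measurable (ICE i).2 by case: (hICE i).
have mE1 : measurable E1 by exact: measurableC.
have mE2 : measurable E2 by apply: measurableC; exact: bigsetU_measurable.
have mE3 : measurable E3 by exact: bigsetU_measurable.
exists (E1 `|` E2 `|` E3).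
  have mE12 : measurable (E1 `|` E2) by exact: measurableU.
  split; first exact: measurableU.
  rewrite prob_EFin ?lte_fin; last exact: measurableU.
  have P1 : prob mu E1 = 0.
    by rewrite /prob probability_setC // [mu _]muHG nuG subee.
  have P2 : prob mu E2 <= eps / 4 by exact: hK.
  have P3 : prob mu E3 <= eps / 4.
    apply: le_trans (prob_bigsetU_le _ _ mICE) _.
    apply: (@le_trans _ _ (\sum_(i < K) (eps / 4 / K.+1%:R))).
      by apply: ler_sum => i _; case: (hICE i).
    rewrite sumr_const card_ord -[_ *+ K]mulr_natr -mulrA ger_pMr //.
    by rewrite mulrC ler_pdivrMr ?mul1r ?ler_nat ?ltr0n.
  have U1 := prob_setU_le mu mE1 mE2.
  have U2 := prob_setU_le mu mE12 mE3.
  lra.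
move=> m nE.
have [Hm Gm] : (H1 `&` phi @^-1` G) m.
  by apply: contrapT => h; apply: nE; left; left.
have [i iK Bm] : (\bigcup_(i in `I_K) B i) m.
  by rewrite bigcup_mkord; apply: contrapT => h; apply: nE; left; right.
have nICE l : (l < K)%N -> ~ (ICE l).2 m.
  move=> lK h; apply: nE; right.
  rewrite /E3 -(bigcup_mkord _ (fun i => (ICE i).2)).
  by exists l.
have CB l : (l < K)%N -> B l m <-> (ICE l).1.2 (ext (dec (F (phi m) 0))).
  move=> lK; have [det _ _ h _] := hICE l; rewrite h //; last exact: nICE.
  have xy : {in (ICE l).1.1, phi m =1 ext (dec (F (phi m) 0))}.
    by apply: ext_coding => // t; exact: n_ge.
  by split; apply: det => // t tI; rewrite xy.
(* The announced ball [l] need not be the ball [i] found above, but by [CB] it also contains [m]. *)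
have [_ _ /(_ _)[|l [lK Cl] AE]] := hA (F (phi m) 0).
  by exists i; split => //; apply/CB.
have Blm : B l m by apply/CB.
have := sA (F (phi m) 0); rewrite AE /B /open_ball /= => Bls.
have [_ [_ [dist_sym tri]]] := mdist.
apply: le_lt_trans (tri m (z l) _) _; rewrite (dist_sym m).
by move: Blm; rewrite /B /open_ball /=; lra.
Qed.
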